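(* Let $m,n$ be positive integers. Suppose $\chi$ is a polynomial vector field on $\mathbb{S}^n$ of degree $m$ having finitely many invariant parallel hyperplanes. Then $\chi$ has at most $m-1$ invariant parallel hyperplanes, counted taking into account multiplicities. Also, this bound is sharp, i.e. it is attained by some polynomial vector field of degree $m$ on $\mathbb{S}^n$ having finitely many invariant parallel hyperplanes.
   Context: $\mathbb{S}^n=\{x\in\mathbb{R}^{n+1} : \sum_i x_i^2=1\}$. A polynomial vector field $\chi=(P_1,\ldots,P_{n+1})$ in $\mathbb{R}^{n+1}$ is identified with the operator $\sum_i P_i\,\partial/\partial x_i$; its degree is $\max_i\deg P_i$. It is a vector field on $\mathbb{S}^n$ if $\chi(\sum_i x_i^2-1)=K(\sum_i x_i^2-1)$ for some real polynomial $K$. The zero set $\{f=0\}$ of a polynomial $f$ is an invariant algebraic set of $\chi$ if $\chi f=Kf$ for some real polynomial $K$. A parallel hyperplane is a hyperplane $\{x_{n+1}-k=0\}$ in $\mathbb{R}^{n+1}$ with $k\in\mathbb{R}$, $|k|<1$. Multiplicity: for a finite-dimensional subspace $W\subset\mathbb{R}[x_1,\ldots,x_{n+1}]$ with basis $v_1,\ldots,v_k$, the extactic polynomial is $\mathcal{E}_W(\chi)=\det\big(\chi^{i-1}(v_j)\big)_{1\le i,j\le k}$, where $\chi^0(v)=v$ and $\chi^{i}(v)=\chi^{i-1}(\chi(v))$. An algebraic set $\{f=0\}$ with $f\in W$ has multiplicity $\mu$ for $\chi$ if $\mathcal{E}_W(\chi)\neq0$, $f^{\mu}$ divides $\mathcal{E}_W(\chi)$,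 and $f^{\mu'}$ does not divide it for any $\mu'>\mu$. For parallel hyperplanes one takes $W=\langle 1,x_{n+1}\rangle$, so that $\mathcal{E}_W(\chi)=P_{n+1}$. *)

(* Defs.v *)
From HB Require Import structures.
From mathcomp Require Import all_boot all_order all_algebra.
From mathcomp Require Import mpoly.
From mathcomp Require Import cardinality reals.

Set Implicit Arguments.
Unset Strict Implicit.
Unset Printing Implicit Defensive.

Import GRing.Theory Num.Theory.
Local Open Scope ring_scope.

(* The polynomial ring in x_1, ..., x_{n+1} is {mpoly R[n.+1]}; x_i is 'X_(i-1),
   so that the last variable x_{n+1} is 'X_ord_max. *)

Definition vfield (R : realType) (d : nat) := 'I_d -> {mpoly R[d]}.

(* msize p is 1 + deg p for p != 0 and msize 0 = 0, so the zero polynomial is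
   given degree 0 here. *)
Definition vfdeg (R : realType) (d : nat) (X : vfield R d) : nat :=
  (\max_(i < d) (msize (X i)).-1)%N.

Definition vfapp (R : realType) (d : nat) (X : vfield R d)
    (f : {mpoly R[d]}) : {mpoly R[d]} :=
  \sum_(i < d) X i * f^`M(i).

Definition mdvd (R : realType) (d : nat) (f g : {mpoly R[d]}) : Prop :=
  exists K : {mpoly R[d]}, g = K * f.

Definition invariant_alg (R : realType) (d : nat) (X : vfield R d)
    (f : {mpoly R[d]}) : Prop :=
  exists K : {mpoly R[d]}, vfapp X f = K * f.

Definition sphere_poly (R : realType) (n : nat) : {mpoly R[n.+1]} :=
  (\sum_(i < n.+1) 'X_i ^+ 2) - 1.

Definition on_sphere (R : realType) (n : nat) (X : vfield R n.+1) : Prop :=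
  exists K : {mpoly R[n.+1]},
    vfapp X (sphere_poly R n) = K * sphere_poly R n.

Definition hyperplane_poly (R : realType) (n : nat) (k : R) : {mpoly R[n.+1]} :=
  'X_ord_max - k%:MP.

Definition inv_parallel (R : realType) (n : nat) (X : vfield R n.+1) (k : R) :
    Prop :=
  `|k| < 1 /\ invariant_alg X (hyperplane_poly n k).

(* Indices start at 0, so row i holds the i-th iterate of X on the basis v. *)
Definition extactic (R : realType) (d : nat) (X : vfield R d) (r : nat)
    (v : 'I_r -> {mpoly R[d]}) : {mpoly R[d]} :=
  \det (\matrix_(i < r, j < r) iter i (vfapp X) (v j)).

Definition in_span (R : realType) (d r : nat) (v : 'I_r -> {mpoly R[d]})
    (f : {mpoly R[d]}) : Prop :=
  exists c : 'I_r -> R, f = \sum_(j < r) c j *: v j.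

(* W is the span of v.  Linear independence of v is not required separately: the
   iterates of X are linear, so a dependent v has zero extactic polynomial. *)
Definition has_multiplicity (R : realType) (d : nat) (X : vfield R d) (r : nat)
    (v : 'I_r -> {mpoly R[d]}) (f : {mpoly R[d]}) (mu : nat) : Prop :=
  [/\ in_span v f,
      extactic X v != 0,
      mdvd (f ^+ mu) (extactic X v)
    & forall mu' : nat, (mu < mu')%N -> ~ mdvd (f ^+ mu') (extactic X v)].

Definition parallel_basis (R : realType) (n : nat) (j : 'I_2) :
    {mpoly R[n.+1]} :=
  if j == ord0 then 1 else 'X_ord_max.

(* A parallel hyperplane {x_{n+1} = k} is identified with k.  The relation says
   that the invariant parallel hyperplanes of X are finite in number, each has a
   multiplicity, and N is the sum of these multiplicities. *)
Definition parallel_count (R : realType) (n : nat) (X : vfield R n.+1)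
    (N : nat) : Prop :=
  exists (s : seq R) (mu : R -> nat),
    [/\ uniq s,
        forall k : R, k \in s <-> inv_parallel X k,
        forall k : R, k \in s ->
          has_multiplicity X (parallel_basis R n) (hyperplane_poly n k) (mu k)
      & N = (\sum_(k <- s) mu k)%N].

(* Main.v *)
Require Import Defs.
From HB Require Import structures.
From mathcomp Require Import all_boot all_order all_algebra.
From mathcomp Require Import mpoly.
From mathcomp Require Import boolp cardinality reals.

Set Implicit Arguments.
Unset Strict Implicit.
Unset Printing Implicit Defensive.

Import GRing.Theory Num.Theory.
Local Open Scope ring_scope.

(** Write P for the last component of X. In the basis 1, x_{n+1} the extactic
    polynomial is P itself ([extactic_parallel]), and X sends x_{n+1} - k to P,
    so the invariant parallel hyperplanes and their multiplicities are the
    factors x_{n+1} - k of P with |k| < 1 and their exponents in P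
    ([inv_parallelE], [parallel_multiplicityE]). If P were zero, every parallel
    hyperplane would be invariant; hence finiteness forces P != 0, and all the
    multiplicities exist.

    The linear forms x_{n+1} - k are pairwise coprime primes, so the product of
    their powers divides P, and the total N of the multiplicities is at most
    deg P <= m ([mdvd_prod_linear], [msize_prod_linear]). What remains is to
    exclude N = m. In that case the cofactor is a nonzero constant c, so that
    P = c * \prod_k (x_{n+1} - k) ^ mu_k. At the north pole tangency to the
    sphere says that P vanishes ([on_sphere_north_pole]), whereas the product
    takes the value c * \prod_k (1 - k) ^ mu_k, which is nonzero because every
    k is less than 1 ([parallel_count_le]).

    The bound is attained by x_{n+1}^(m-1) times the infinitesimal rotation in
    the plane of x_1 and x_{n+1}: there P = x_{n+1}^(m-1) * x_1, and the only
    possible invariant parallel hyperplane is the equator x_{n+1} = 0, with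
    multiplicity m - 1 ([parallel_count_twisted_rotation]). *)

(** * Divisibility by a linear form x_i - k *)

Section LinearFactors.

Variables (R : realType) (d : nat).
Implicit Types (f g h p q : {mpoly R[d]}) (i j : 'I_d) (k l : R).

(** Substitution of k for x_i. It plays the role of the quotient map modulo
    x_i - k; since it takes values in a domain, it makes the primality of
    x_i - k usable by plain evaluation. *)
Definition slice i k p : {mpoly R[d]} :=
  p \mPo [tuple (if j == i then k%:MP else 'X_j) | j < d].

HB.instance Definition _ i k := GRing.RMorphism.copy (slice i k)
  (comp_mpoly [tuple (if j == i then k%:MP else 'X_j) | j < d]).

Lemma sliceC i k c : slice i k c%:MP = c%:MP.
Proof. exact: comp_mpolyC. Qed.

Lemma sliceX i k j : slice i k 'X_j = if j == i then k%:MP else 'X_j.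
Proof. by rewrite /slice comp_mpolyXU -tnth_nth tnth_mktuple. Qed.

Lemma mdvdD f p q : mdvd f p -> mdvd f q -> mdvd f (p + q).
Proof. by move=> [a ->] [b ->]; exists (a + b); rewrite mulrDl. Qed.

Lemma mdvdMl f p q : mdvd f q -> mdvd f (p * q).
Proof. by move=> [b ->]; exists (p * b); rewrite mulrA. Qed.

Lemma mdvd_sub_sliceM i k p q :
  mdvd ('X_i - k%:MP) (p - slice i k p) ->
  mdvd ('X_i - k%:MP) (q - slice i k q) ->
  mdvd ('X_i - k%:MP) (p * q - slice i k (p * q)).
Proof.
move=> dp dq; rewrite rmorphM /=.
have -> : p * q - slice i k p * slice i k q =
  p * (q - slice i k q) + slice i k q * (p - slice i k p).
  by rewrite !mulrBr ![slice i k q * _]mulrC addrA subrK.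
by apply: mdvdD; apply: mdvdMl.
Qed.

(** The polynomials congruent to their slice modulo x_i - k are closed under
    sums and products and contain the constants and the variables. *)
Lemma mdvd_sub_slice i k p : mdvd ('X_i - k%:MP) (p - slice i k p).
Proof.
have dC c : mdvd ('X_i - k%:MP) (c%:MP - slice i k c%:MP).
  by exists 0; rewrite sliceC subrr mul0r.
have d1 : mdvd ('X_i - k%:MP) (1 - slice i k 1) by rewrite -mpolyC1.
elim/mpolyind: p => [|c m p _ _ dp].
  by exists 0; rewrite rmorph0 subrr mul0r.
rewrite rmorphD opprD addrACA; apply: mdvdD => //.
rewrite -mul_mpolyC; apply: mdvd_sub_sliceM; first exact: dC.
rewrite (mpolyXE_id _ m); elim/big_rec: _ => [|j q _ dq]; first exact: d1.
apply: mdvd_sub_sliceM dq; elim: (m j) => [|e dj]; first exact: d1.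
rewrite exprS; apply: mdvd_sub_sliceM dj.
rewrite sliceX; case: eqP => [->|_]; first by exists 1; rewrite mul1r.
by exists 0; rewrite subrr mul0r.
Qed.

Lemma slice_linear i k l : slice i k ('X_i - l%:MP) = (k - l)%:MP.
Proof. by rewrite rmorphB /= sliceX eqxx sliceC mpolyCB. Qed.

Lemma mdvd_linearP i k p : mdvd ('X_i - k%:MP) p <-> slice i k p = 0.
Proof.
split=> [[q ->]|s0]; first by rewrite rmorphM /= slice_linear subrr mulr0.
by have := mdvd_sub_slice i k p; rewrite s0 subr0.
Qed.

Lemma msize_linear i k : msize ('X_i - k%:MP : {mpoly R[d]}) = 2%N.
Proof.
apply/eqP; rewrite eqn_leq; apply/andP; split.
  apply: leq_trans (mmeasureD_le _ _ _) _; rewrite mmeasureN mmeasureC.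
  by rewrite geq_max mmeasureX /= mdeg1 /=; apply: leq_trans (leq_b1 _) _.
rewrite -{1}(mdeg1 i); apply: msize_mdeg_lt; rewrite mcoeff_msupp mcoeffB mcoeffXU mcoeffC.
by rewrite eqxx mnm1_eq0 mulr0 subr0 oner_neq0.
Qed.

Lemma mpolyXU_neq0 i : 'X_i != 0 :> {mpoly R[d]}.
Proof. by rewrite -msize_poly_eq0 msizeX. Qed.

Lemma linear_neq0 i k : 'X_i - k%:MP != 0 :> {mpoly R[d]}.
Proof. by rewrite -msize_poly_eq0 msize_linear. Qed.

(** The factors x_i - k are moved one at a time from q * h to q: each is prime,
    and a nonzero slice keeps it from dividing h. *)
Lemma linear_expM_cancel i k q h a : slice i k h != 0 ->
  mdvd (('X_i - k%:MP) ^+ a) (q * h) -> mdvd (('X_i - k%:MP) ^+ a) q.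
Proof.
move=> h0; elim: a q => [|a IH] q; first by exists q; rewrite mulr1.
case=> b eqb.
have /mdvd_linearP [q' eqq] : slice i k q = 0.
  apply/eqP; have /eqP := congr1 (slice i k) eqb.
  rewrite exprS !rmorphM /= slice_linear subrr !(mul0r, mulr0) mulf_eq0.
  by rewrite (negPf h0) orbF.
rewrite eqq exprS.
have [|c ->] := IH q'; last by exists c; rewrite mulrAC mulrA.
exists b; apply: (mulIf (linear_neq0 i k)).
by rewrite mulrAC -eqq eqb exprSr mulrA.
Qed.

(** For distinct k and l the slice of x_i - l at k is the nonzero constant
    k - l, so the power of x_i - k can be cancelled against the others. *)
Lemma mdvd_prod_linear i p (s : seq R) (mu : R -> nat) : uniq s ->
  (forall k, k \in s -> mdvd (('X_i - k%:MP) ^+ mu k) p) ->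
  mdvd (\prod_(k <- s) ('X_i - k%:MP) ^+ mu k) p.
Proof.
elim: s => [|k s IH] /=; first by exists p; rewrite big_nil mulr1.
case/andP=> ks us dv.
have [|q eqp] := IH us; first by move=> l ls; apply: dv; rewrite inE ls orbT.
have : mdvd (('X_i - k%:MP) ^+ mu k) q.
  apply: (@linear_expM_cancel _ _ _ (\prod_(l <- s) ('X_i - l%:MP) ^+ mu l)).
    rewrite rmorph_prod prodf_seq_neq0; apply/allP => l ls /=.
    rewrite rmorphXn /= slice_linear expf_neq0 // mpolyC_eq0 subr_eq0.
    by apply: contraNneq ks => ->.
  by rewrite -eqp; apply: dv; rewrite inE eqxx.
by case=> c eqq; exists c; rewrite big_cons mulrA -eqq.
Qed.

Lemma msize_prod_linear i (s : seq R) (mu : R -> nat) :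
  msize (\prod_(k <- s) ('X_i - k%:MP) ^+ mu k : {mpoly R[d]}) =
  (\sum_(k <- s) mu k).+1.
Proof.
have nzX k a : ('X_i - k%:MP) ^+ a != 0 :> {mpoly R[d]}.
  by rewrite expf_neq0 // linear_neq0.
have szX k a : msize (('X_i - k%:MP) ^+ a : {mpoly R[d]}) = a.+1.
  elim: a => [|a IH]; first by rewrite msize1.
  by rewrite exprS msizeM ?linear_neq0 // msize_linear IH.
elim: s => [|k s IH]; first by rewrite !big_nil msize1.
rewrite !big_cons msizeM //; first by rewrite szX IH addSn addnS.
by rewrite -msize_poly_eq0 IH.
Qed.

(** Dividing by x_i - k lowers the degree, so the division stops, and it stops
    exactly when the quotient has a nonzero slice. *)
Lemma linear_multiplicity i k p : p != 0 ->
  exists a q, p = q * ('X_i - k%:MP) ^+ a /\ slice i k q != 0.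
Proof.
have [N leN] := ubnP (msize p); elim: N => // N IH in p leN *.
move=> p0; have [s0|] := eqVneq (slice i k p) 0; last first.
  by exists 0, p; rewrite mulr1.
have /mdvd_linearP [r eqr] := s0.
have r0 : r != 0 by apply: contraNneq p0 => r0; rewrite eqr r0 mul0r.
have [||a [q [eqq sq]]] := IH r; rewrite //.
  move: leN; rewrite eqr msizeM ?linear_neq0 // msize_linear addn2 /=.
  by rewrite ltnS.
by exists a.+1, q; rewrite exprSr mulrA -eqq.
Qed.

Lemma mdvd_linear_exp_bound i k q a b : slice i k q != 0 ->
  mdvd (('X_i - k%:MP) ^+ b) (q * ('X_i - k%:MP) ^+ a) -> (b <= a)%N.
Proof.
move=> sq; apply: contraPleq => ltab [c].
rewrite -(subnK ltab) addnS -addSn exprD mulrA.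
move/(mulIf (expf_neq0 a (linear_neq0 i k))) => eqq.
move: sq; rewrite eqq exprS !rmorphM /= slice_linear subrr !(mul0r, mulr0).
by rewrite eqxx.
Qed.

End LinearFactors.

(** * The extactic polynomial of the parallel hyperplanes *)

Section Parallel.

Variables (R : realType) (n : nat).
Implicit Types (X : vfield R n.+1) (k : R).

Lemma mderivXU (d : nat) (i j : 'I_d) :
  ('X_i : {mpoly R[d]})^`M(j) = (i == j)%:R.
Proof.
rewrite mderivX mnm1E; case: eqP => [->|_]; last by rewrite scale0r.
by rewrite scale1r -{1}[U_(j)%MM]add0m addmK mpolyX0.
Qed.

Lemma vfappC (d : nat) (X : vfield R d) (c : R) : vfapp X c%:MP = 0.
Proof. by rewrite /vfapp big1 // => i _; rewrite mderivC mulr0. Qed.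

Lemma vfappX (d : nat) (X : vfield R d) (i : 'I_d) : vfapp X 'X_i = X i.
Proof.
rewrite /vfapp (bigD1 i) //= mderivXU eqxx mulr1 big1 ?addr0 // => j ji.
by rewrite mderivXU eq_sym (negPf ji) mulr0.
Qed.

(** The value does not depend on k, hence all the invariance conditions for
    parallel hyperplanes are divisibility conditions on one polynomial. *)
Lemma vfapp_hyperplane X k : vfapp X (hyperplane_poly n k) = X ord_max.
Proof.
rewrite -[RHS]vfappX /vfapp; apply: eq_bigr => i _.
by rewrite mderivB mderivC subr0.
Qed.

Lemma inv_parallelE X k : inv_parallel X k <->
  `|k| < 1 /\ mdvd (hyperplane_poly n k) (X ord_max).
Proof. by rewrite /inv_parallel /invariant_alg vfapp_hyperplane. Qed.

Lemma extactic_parallel X : extactic X (parallel_basis R n) = X ord_max.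
Proof.
rewrite /extactic (expand_det_row _ ord0) big_ord_recl big_ord1 !mxE /=.
rewrite /parallel_basis /=.
rewrite /cofactor !det_mx11 !mxE /=.
rewrite vfappX -[X in vfapp _ X]mpolyC1 vfappC !mulr0 addr0.
by rewrite expr0 !mul1r.
Qed.

Lemma in_span_parallel k : in_span (parallel_basis R n) (hyperplane_poly n k).
Proof.
exists (fun j => if j == ord0 then - k else 1).
rewrite big_ord_recl big_ord1 /= /parallel_basis /= scale1r scaleNr.
by rewrite addrC -mul_mpolyC mulr1.
Qed.

(** A multiplicity in this form, with a cofactor not divisible by x_{n+1} - k,
    can be produced and consumed without quantifying over larger exponents. *)
Lemma parallel_multiplicityE X k a : has_multiplicity X (parallel_basis R n)
    (hyperplane_poly n k) a <->
  exists q, X ord_max = q * hyperplane_poly n k ^+ a /\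
    slice ord_max k q != 0.
Proof.
rewrite /has_multiplicity extactic_parallel.
split=> [[_ X0 [q eqX] max]|[q [eqX sq]]].
- exists q; split=> //; apply/eqP => /mdvd_linearP [r eqr].
  by apply: (max a.+1) => //; exists r; rewrite eqX eqr exprS mulrA.
- split; rewrite ?eqX.
  + exact: in_span_parallel.
  + rewrite mulf_neq0 ?expf_neq0 ?linear_neq0 //.
    by apply: contraNneq sq => ->; rewrite rmorph0.
  + by exists q.
  + by move=> b ltab /(mdvd_linear_exp_bound sq); rewrite leqNgt ltab.
Qed.

Lemma finite_inv_parallel_neq0 X :
  finite_set (inv_parallel X) -> X ord_max != 0.
Proof.
case/finite_seqP=> s eqs; apply/eqP => X0.
(* The values 1/2, 1/3, 1/4, ... are more parallel hyperplanes than s holds. *)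
pose v := fun j : nat => (j.+2%:R : R)^-1.
have v_inj : injective v.
  by move=> a b /invr_inj /eqP; rewrite eqr_nat => /eqP [].
have sub : {subset map v (iota 0 (size s).+1) <= s}.
  move=> k /mapP[j _ ->].
  have : inv_parallel X (v j).
    apply/inv_parallelE; split; last by exists 0; rewrite X0 mul0r.
    by rewrite ger0_norm ?invr_ge0 // invf_lt1 // ltr1n.
  by rewrite eqs.
have := uniq_leq_size _ sub.
by rewrite map_inj_uniq // iota_uniq size_map size_iota ltnn => /(_ isT).
Qed.

Lemma parallel_count_exists X :
  finite_set (inv_parallel X) -> exists N, parallel_count X N.
Proof.
move=> fin; have X0 := finite_inv_parallel_neq0 fin.
case/finite_seqP: fin => s eqs.
have [mu muP] := choice (fun k => linear_multiplicity ord_max k X0).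
exists (\sum_(k <- undup s) mu k)%N, (undup s), mu.
split=> [|k|k _|//]; first exact: undup_uniq.
  by rewrite mem_undup eqs.
by apply/parallel_multiplicityE; exact: muP.
Qed.

Definition north_pole (i : 'I_n.+1) : R := (i == ord_max)%:R.

Lemma vfapp_sphere X :
  vfapp X (sphere_poly R n) = \sum_i X i * ('X_i *+ 2).
Proof.
apply: eq_bigr => i _; congr (_ * _).
rewrite mderivB -mpolyC1 mderivC subr0 linear_sum (bigD1 i) //= big1.
  by rewrite addr0 expr2 mderivM mderivXU eqxx mul1r mulr1 -mulr2n.
by move=> j /negPf ji; rewrite expr2 mderivM mderivXU ji mul0r mulr0 addr0.
Qed.

(** On the sphere tangency reads sum_i x_i * X_i = 0, and at the north pole
    only the last summand survives. *)
Lemma on_sphere_north_pole X : on_sphere X -> (X ord_max).@[north_pole] = 0.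
Proof.
case=> K /(congr1 (meval north_pole)); rewrite vfapp_sphere.
have sphere0 : (sphere_poly R n).@[north_pole] = 0.
  rewrite mevalB meval1 rmorph_sum (bigD1 ord_max) //= big1 => [|j /negPf jn].
    by rewrite rmorphXn /= mevalXU /north_pole eqxx expr1n addr0 subrr.
  by rewrite rmorphXn /= mevalXU /north_pole jn expr0n.
rewrite mevalM sphere0 mulr0 rmorph_sum (bigD1 ord_max) //= big1; last first.
  move=> j /negPf jn.
  by rewrite mevalM mevalMn mevalXU /north_pole jn mul0rn mulr0.
rewrite mevalM mevalMn mevalXU /north_pole eqxx addr0 => /eqP.
by rewrite mulf_eq0 pnatr_eq0 orbF => /eqP.
Qed.

(** Counting degrees alone gives N <= deg X. The missing unit comes from the
    north pole, where X ord_max vanishes but no invariant parallel hyperplane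
    passes. *)
Lemma parallel_count_le X N : (0 < vfdeg X)%N -> on_sphere X ->
  finite_set (inv_parallel X) -> parallel_count X N -> (N <= vfdeg X - 1)%N.
Proof.
move=> m0 sph fin [s [mu [us sP muP ->]]].
have X0 := finite_inv_parallel_neq0 fin.
have [|q eqX] := @mdvd_prod_linear _ _ ord_max (X ord_max) s mu us.
  by move=> k /muP/parallel_multiplicityE [q [-> _]]; exists q.
have q0 : q != 0 by apply: contraNneq X0 => q0; rewrite eqX q0 mul0r.
have szX : msize (X ord_max) = (msize q + \sum_(k <- s) mu k)%N.
  by rewrite eqX msizeM // -?msize_poly_eq0 msize_prod_linear ?addnS.
have : ((msize (X ord_max)).-1 <= vfdeg X)%N by apply: leq_bigmax.
(* A nonconstant cofactor q already accounts for one degree. *)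
rewrite szX; case: (ltnP 1 (msize q)) => [|/msize1_polyC].
  case: (msize q) => [|[|e]] // _ le; rewrite leq_subRL // add1n.
  by apply: leq_trans le; rewrite !addSn ltnS leq_addl.
(* If q is a constant c, all the zeros of X ord_max have height below 1. *)
move: (q@_0) => c qc _; have c0 : c != 0 by rewrite -(mpolyC_eq0 n.+1) -qc.
move/eqP: (on_sphere_north_pole sph).
rewrite eqX qc mevalM mevalC rmorph_prod mulf_eq0 (negPf c0) prodf_seq_eq0 /=.
case/hasP=> k /sP [k1 _].
rewrite rmorphXn /= mevalB mevalXU mevalC /north_pole eqxx expf_eq0 subr_eq0.
by case/andP=> _ /eqP k1'; move: k1; rewrite -k1' normr1 Order.POrderTheory.ltxx.
Qed.

End Parallel.

(** * A field attaining the bound *)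

Section Sharp.

Variables (R : realType) (n : nat).

(** A rotation is tangent to the sphere, and so is any polynomial multiple of
    it. The rotation moves the last coordinate against x_1, rather than fixing
    it, so that its last component x_1 is nonzero and free of x_{n+1}. *)
Definition twisted_rotation (e : nat) : vfield R n.+1 := fun i =>
  if i == ord_max then 'X_ord_max ^+ e * 'X_ord0
  else if i == ord0 then - 'X_ord_max ^+ e.+1 else 0.

Lemma ord0_neq_max : (0 < n)%N -> (ord0 == ord_max :> 'I_n.+1) = false.
Proof. by rewrite lt0n -val_eqE eq_sym /= => /negPf. Qed.

Lemma twisted_rotation_on_sphere e : (0 < n)%N ->
  on_sphere (twisted_rotation e).
Proof.
move=> n0; exists 0; rewrite mul0r vfapp_sphere (bigD1 ord_max) //=.
rewrite (bigD1 ord0) ?ord0_neq_max //= big1 /twisted_rotation => [|i].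
  rewrite !eqxx ord0_neq_max // addr0 exprSr !mulrnAr mulNr mulNrn.
  by rewrite mulrAC subrr.
by case/andP=> /negPf -> /negPf ->; rewrite mul0r.
Qed.

Lemma vfdeg_twisted_rotation e : (0 < n)%N ->
  vfdeg (twisted_rotation e) = e.+1.
Proof.
move=> n0.
have szmax : msize (twisted_rotation e ord_max) = e.+2.
  rewrite /twisted_rotation eqxx mpolyXn -mpolyXD msizeX mdegD mdegMn !mdeg1.
  by rewrite mul1n addn1.
apply/eqP; rewrite eqn_leq; apply/andP; split.
  apply/bigmax_leqP => i _; have [->|/negPf im] := eqVneq i ord_max.
    by rewrite szmax.
  rewrite /twisted_rotation im; case: ifP => _; last by rewrite msize0.
  by rewrite mmeasureN mpolyXn msizeX mdegMn mdeg1 mul1n.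
by apply: leq_trans (leq_bigmax ord_max); rewrite szmax.
Qed.

Lemma slice_twisted_rotation e k : (0 < n)%N ->
  slice ord_max k (twisted_rotation e ord_max) = k%:MP ^+ e * 'X_ord0.
Proof.
move=> n0; rewrite /twisted_rotation eqxx rmorphM rmorphXn /= !sliceX eqxx.
by rewrite ord0_neq_max.
Qed.

(** The list is empty when e = 0: the equator is invariant only because of the
    factor x_{n+1}^e. *)
Lemma inv_parallel_twisted_rotation e k : (0 < n)%N ->
  inv_parallel (twisted_rotation e) k <-> k \in nseq (0 < e) 0.
Proof.
move=> n0; rewrite mem_nseq lt0b; split=> [/inv_parallelE [_]|/andP[e0 /eqP ->]].
  move=> /mdvd_linearP; rewrite slice_twisted_rotation // => /eqP.
  by rewrite mulf_eq0 expf_eq0 mpolyC_eq0 (negPf (mpolyXU_neq0 _ _)) orbF.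
apply/inv_parallelE; split; first by rewrite normr0 ltr01.
apply/mdvd_linearP; rewrite slice_twisted_rotation // expr0n.
by move: e0; rewrite lt0n => /negPf ->; rewrite mul0r.
Qed.

Lemma parallel_count_twisted_rotation e : (0 < n)%N ->
  parallel_count (twisted_rotation e) e.
Proof.
move=> n0; exists (nseq (0 < e) 0), (fun=> e); split.
- by case: (0 < e)%N.
- by move=> k; rewrite inv_parallel_twisted_rotation.
- move=> k; rewrite mem_nseq => /andP[_ /eqP ->].
  apply/parallel_multiplicityE; exists 'X_ord0; split.
    by rewrite /twisted_rotation eqxx /hyperplane_poly subr0 mulrC.
  by rewrite sliceX ord0_neq_max // mpolyXU_neq0.
- by case: e => [|e]; rewrite ?big_nil ?big_seq1.
Qed.

End Sharp.

Theorem theorem1p4 (R : realType) (m n : nat) (hm : (0 < m)%N) (hn : (0 < n)%N) :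
  (forall X : vfield R n.+1,
      on_sphere X -> vfdeg X = m -> finite_set (inv_parallel X) ->
      (exists N : nat, parallel_count X N) /\
      (forall N : nat, parallel_count X N -> (N <= m - 1)%N)) /\
  (exists X : vfield R n.+1,
      [/\ on_sphere X, vfdeg X = m, finite_set (inv_parallel X)
        & parallel_count X (m - 1)%N]).
Proof.
split=> [X sph degX fin|].
  split; first exact: parallel_count_exists.
  by move=> N cX; rewrite -degX; apply: parallel_count_le; rewrite ?degX.
exists (@twisted_rotation R n (m - 1)%N); split.
- exact: twisted_rotation_on_sphere.
- by rewrite vfdeg_twisted_rotation // subn1 prednK.
- apply/finite_seqP; exists (nseq (0 < m - 1) 0); apply/predeqP => k.
  exact: inv_parallel_twisted_rotation.
- exact: parallel_count_twisted_rotation.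
Qed.
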